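(* Consider the functional $J(W,a)=\mathbb{E}[U_P(X^a-W)]$. (1) If $J$ is strongly upper semicontinuous on $C_m^M$ (i.e. with respect to the norm of $E$), then the problem $\sup_{(W,a)\in C_m^M}\mathbb{E}[U_P(X^a-W)]$ has a maximizer, i.e. the supremum is attained at some $(W^*,a^* )\in C_m^M$. (2) If $J$ is strongly upper semicontinuous on $C_m$, and if both of the following conditions hold: (i) $\operatorname{supp}(B)\subset[b_1,b_2]$ for some $(b_1,b_2)\in\mathbb{R}^2$; (ii) $U_P'''\ge 0$; then the problem $\sup_{(W,a)\in C_m}\mathbb{E}[U_P(X^a-W)]$ has a maximizer.
   Context: Let $\Omega$ be an uncountable sample space, $(\Omega,\mathbb{F},\mathbb{P})$ a probability space, $L^2(\Omega)$ the square-integrable real random variables, and $B\in L^2(\Omega)$. Fix $x_0\in\mathbb{R}$, $K>0$; set $X^a=x_0+a+B$ and $\kappa(a)=K a^2/2$ for $a\in\mathbb{R}$. $E=L^2(\Omega)\times\mathbb{R}$ is the Hilbert space with norm $\|(W,a)\|_E=\sqrt{\mathbb{E}[W^2]+|a|^2}$. The utility functions $U_P,U_A:\mathbb{R}\to\mathbb{R}$ are continuous, twice differentiable, with $U_P'>0$, $U_P''\le 0$, $U_A'>0$, $U_A''\le 0$ and $\lim_{x\to-\infty}U_P(x)=\lim_{x\to-\infty}U_A(x)=-\infty$. Fix $y\ge0$ and $0\le m\le y$; when $M$ is involved, also $y\le M$. Assume $\mathbb{E}[|U_P(X^0-y)|]<\infty$. Expectations of $U_P(X^a-W)$ and $U_A(W-\kappa(a))$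 are understood in $[-\infty,\infty)$. Define $C_m^M=\{(W,a)\in E: m\le W\le M\ \mathbb{P}\text{-a.s.},\ \mathbb{E}[U_A(W-\kappa(a))]\ge U_A(y)\}$ and $C_m=\{(W,a)\in E: m\le W\ \mathbb{P}\text{-a.s.},\ \mathbb{E}[U_A(W-\kappa(a))]\ge U_A(y)\}$. A functional $f$ is upper semicontinuous on a set if $f(W,a)\ge\limsup_n f(W_n,a_n)$ for every sequence $(W_n,a_n)$ in the set converging in norm to $(W,a)$ in the set. *)

(* Defs.v *)
From HB Require Import structures.
From mathcomp Require Import all_boot all_order all_algebra.
From mathcomp Require Import all_classical all_reals all_analysis.
Set Implicit Arguments.
Unset Strict Implicit.
Unset Printing Implicit Defensive.
Import Order.TTheory GRing.Theory Num.Theory.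
Import numFieldNormedType.Exports.
Local Open Scope classical_set_scope.
Local Open Scope ring_scope.

Record is_utility (R : realType) (U : R -> R) : Prop := IsUtility {
  utility_continuous : continuous U ;
  utility_derivable : forall x : R, derivable U x 1 ;
  utility_derivable2 : forall x : R, derivable (derive1 U) x 1 ;
  utility_increasing : forall x : R, 0 < derive1 U x ;
  utility_concave : forall x : R, derive1n 2 U x <= 0 ;
  utility_ninfty : U x @[x --> -oo] --> -oo }.

(* Topological support of a measure on R: for the law of a random variable,
   the smallest closed set of probability one. *)
Definition measure_support (R : realType)
    (mu : set (measurableTypeR R) -> \bar R) : set R :=
  [set x | forall V : set R, open V -> V x -> (0 < mu V)%E].

(* Square-integrable random variables are represented by functions rather than
   by classes modulo a.s. equality; the norm, the admissible sets and the
   objective below do not depend on the representative. *)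
Notation L2 P := (LfunType P (lee1n 2)).

Section contract.
Context (d : measure_display) (T : measurableType d) (R : realType).
Variable P : probability T R.

Local Notation E := (L2 P * R)%type.

Definition normE (u : E) : R :=
  Num.sqrt (fine 'E_P[fun w => u.1 w ^+ 2] + `|u.2| ^+ 2).

Definition cvgE (u : nat -> E) (v : E) : Prop :=
  normE (u n - v) @[n --> \oo] --> (0 : R).

Definition strongly_usc_on (A : set E) (f : E -> \bar R) : Prop :=
  forall (u : nat -> E) (v : E), (forall n, A (u n)) -> A v -> cvgE u v ->
    (limn_esup (f \o u) <= f v)%E.

Definition has_maximizer (A : set E) (f : E -> \bar R) : Prop :=
  exists2 v, A v & f v = ereal_sup [set f u | u in A].

Definition outcome (x0 : R) (B : L2 P) (a : R) : T -> R :=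
  fun w => x0 + a + B w.

Definition effort_cost (K a : R) : R := K * a ^+ 2 / 2.

(* A concave function of a square-integrable variable has an integrable positive
   part, so the integrals below are never an undefined difference of
   infinities and lie in [-oo, +oo[. *)
Definition principal_value (UP : R -> R) (x0 : R) (B : L2 P) (u : E) : \bar R :=
  'E_P[fun w => UP (outcome x0 B u.2 w - u.1 w)].

Definition agent_value (UA : R -> R) (K : R) (u : E) : \bar R :=
  'E_P[fun w => UA (u.1 w - effort_cost K u.2)].

Definition admissible_bounded (UA : R -> R) (K y m M : R) : set E :=
  [set u : E | {ae P, forall w, m <= u.1 w <= M} /\
           ((UA y)%:E <= agent_value UA K u)%E].

Definition admissible (UA : R -> R) (K y m : R) : set E :=
  [set u : E | {ae P, forall w, m <= u.1 w} /\
           ((UA y)%:E <= agent_value UA K u)%E].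

End contract.

Arguments admissible_bounded {d T R} P UA K y m M _.
Arguments admissible {d T R} P UA K y m _.

(* Main.v *)
Require Import Defs.
From HB Require Import structures.
From mathcomp Require Import all_boot all_order all_algebra.
From mathcomp Require Import all_classical all_reals all_analysis.
From mathcomp Require Import measurable_realfun.
From mathcomp Require Import ring lra.
Import Order.TTheory GRing.Theory Num.Theory.
Import numFieldNormedType.Exports.
Local Open Scope classical_set_scope.
Local Open Scope ring_scope.

(** The space of contracts is a Hilbert space, the admissible set is convex and
sequentially closed, and the objective is concave, so a bounded maximizing
sequence can be improved into a convergent one.  Weak compactness is replaced
by a projection argument: given levels c_n increasing to the supremum, the sets
D_n of admissible contracts of value at least c_n are nested and closed under
midpoints, and if they meet a fixed ball, then near-minimizers of the norm over
the D_n form a Cauchy sequence by the parallelogram identity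
([near_minimal_sequence]).  Its limit exists by completeness of L2
([L2_fast_cauchy_cvg], [contract_space_complete]), is admissible by Fatou's
lemma applied to the nonnegative gap between the agent's utility and its
tangent at 0 ([agent_value_closed]), and is optimal by upper semicontinuity
([usc_concave_maximizer]).

What remains is the ball: every admissible contract u of value at least c must
be dominated by an admissible contract whose norm is bounded in terms of c.

When wages lie in [m, M], Jensen's inequality for the agent gives
y + K a^2 / 2 <= E[W] <= M, which bounds a.

When wages are only bounded below, Jensen's inequality for the principal adds
E[W] <= a + const, and a quadratic function of a below an affine one bounds
both a and E[W] ([participation_bound]).  The second moment of W is handled by
two cases.  If UP'' z < 0 for some z, then UP'' <= UP'' z to the left of z
because UP''' >= 0, so UP decreases at least quadratically at -oo; since B lies
a.s. in its support ([ae_in_support]), the principal's wealth is bounded above,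
and its second moment is bounded ([risk_averse_sqnorm_le]).  Otherwise UP is affine, and replacing W by the
constant E[W] keeps the principal's value, does not decrease the agent's, and
yields a contract of bounded norm ([risk_neutral_replacement]). *)

Set Implicit Arguments.
Unset Strict Implicit.
Unset Printing Implicit Defensive.

(** * Concave and prudent utility functions *)

Lemma is_derive_nonincreasing_tangent (R : realType) (f f' : R -> R) :
  (forall x, is_derive (x : R) (1 : R) f (f' x)) ->
  (forall x t, x <= t -> f' t <= f' x) ->
  forall x z, f x <= f z + f' z * (x - z).
Proof.
move=> df f'_ni x z.
have fc a b : {within `[a, b], continuous f}.
  apply: continuous_subspaceT => t.
  by apply: differentiable_continuous; apply/derivable1_diffP; apply: ex_derive.
have [zx|xz|->] := ltgtP z x; last by rewrite subrr mulr0 addr0.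
- have [c + fE] := MVT zx (fun t _ => df t) (fc z x).
  rewrite in_itv/= => /andP[zc cx].
  by rewrite -lerBlDl fE ler_wpM2r ?subr_ge0 ?(ltW zx)// f'_ni// ltW.
- have [c + fE] := MVT xz (fun t _ => df t) (fc x z).
  rewrite in_itv/= => /andP[xc cz].
  rewrite -subr_ge0.
  have -> : f z + f' z * (x - z) - f x = (f' c - f' z) * (z - x).
    by rewrite mulrBl -fE; ring.
  by rewrite mulr_ge0// subr_ge0 ?(ltW xz)// f'_ni// ltW.
Qed.

Lemma is_derive_le0_nonincreasing (R : realType) (f f' : R -> R) :
  (forall x, is_derive (x : R) (1 : R) f (f' x)) -> (forall x, f' x <= 0) ->
  forall x t, x <= t -> f t <= f x.
Proof.
move=> df f'_le0 x t; rewrite le_eqVlt => /predU1P[->//|xt].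
have fc : {within `[x, t], continuous f}.
  apply: continuous_subspaceT => s.
  by apply: differentiable_continuous; apply/derivable1_diffP; apply: ex_derive.
have [c _ fE] := MVT xt (fun s _ => df s) fc.
by rewrite -subr_le0 fE mulr_le0_ge0// subr_ge0 ltW.
Qed.

Section utility.
Context (R : realType) (U : R -> R).
Hypothesis hU : is_utility U.

Let dU x : is_derive (x : R) (1 : R) U (derive1 U x).
Proof.
by rewrite derive1E; apply: derivableP; exact: utility_derivable.
Qed.

Let dU' x : is_derive (x : R) (1 : R) (derive1 U) (derive1n 2 U x).
Proof.
rewrite /derive1n/= derive1E.
by apply: derivableP; exact: utility_derivable2.
Qed.

Let dN (g g' : R -> R) : (forall t : R, is_derive (t : R) (1 : R) g (g' t)) ->
  forall t : R, is_derive (t : R) (1 : R) (- g) ((- g') t).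
Proof. by move=> dg t; exact: is_deriveN. Qed.

Lemma utility_tangent x z : U x <= U z + derive1 U z * (x - z).
Proof.
apply: (is_derive_nonincreasing_tangent dU) => s t.
apply: (is_derive_le0_nonincreasing dU') => r.
exact: utility_concave.
Qed.

Lemma utility_nondecreasing x z : x <= z -> U x <= U z.
Proof.
move=> xz; apply: (le_trans (utility_tangent x z)).
rewrite gerDl mulr_ge0_le0 ?subr_le0// ltW//.
exact: utility_increasing.
Qed.

Lemma utility_le_cancel x z : U x <= U z -> x <= z.
Proof.
apply: contraTT; rewrite -!ltNge => zx.
apply: (le_lt_trans (utility_tangent z x)).
rewrite gtrDl pmulr_rlt0 ?subr_lt0//.
exact: utility_increasing.
Qed.

(** Average the tangent inequalities at the midpoint. *)
Lemma utility_midpoint x z : (U x + U z) / 2 <= U ((x + z) / 2).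
Proof.
have := utility_tangent x ((x + z) / 2); have := utility_tangent z ((x + z) / 2).
set c := derive1 U _; nra.
Qed.

(** The tangent at 0 has positive slope, so it exceeds c only on a half-line
bounded below. *)
Lemma utility_bounded_below c : {z | forall x, c <= U x -> z <= x}.
Proof.
have U'0 := utility_increasing hU 0.
exists ((c - U 0) / derive1 U 0) => x cx.
by rewrite ler_pdivrMr// mulrC lerBlDl (le_trans cx)// -{2}[x]subr0 utility_tangent.
Qed.

Lemma utility_continuous_measurable : measurable_fun [set: R] U.
Proof. exact: continuous_measurable_fun (utility_continuous hU). Qed.

Lemma utility_affine : (forall x, derive1n 2 U x = 0) ->
  forall x, U x = U 0 + derive1 U 0 * x.
Proof.
move=> U''0.
have U'_ni : forall s t, s <= t -> derive1 U t <= derive1 U s.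
  by apply: (is_derive_le0_nonincreasing dU') => t; rewrite U''0.
have U'_nd s t : s <= t -> - derive1 U t <= - derive1 U s.
  apply: (is_derive_le0_nonincreasing (dN dU')) => r.
  by rewrite -[(- _) r]/(- derive1n 2 U r) U''0 oppr0.
move=> x; apply/eqP; rewrite eq_le; apply/andP; split.
  by have := utility_tangent x 0; rewrite subr0.
have : - U x <= - U 0 + - derive1 U 0 * (x - 0).
  exact: (is_derive_nonincreasing_tangent (dN dU) U'_nd).
by rewrite subr0; lra.
Qed.

Hypothesis U3 :
  forall x : R, derivable (derive1n 2 U) x 1 /\ 0 <= derive1n 3 U x.

Let dU'' x : is_derive (x : R) (1 : R) (derive1n 2 U) (derive1n 3 U x).
Proof.
by rewrite [derive1n 3 U]/derive1n iterS derive1E; apply: derivableP; have [] := U3 x.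
Qed.

(** The two sides agree at z, and the right-hand side minus U has a nonpositive
derivative: since U''' >= 0, the marginal utility U' is convex, hence above its
tangent at z. *)
Lemma prudent_utility_quadratic x z : x <= z ->
  U x <= U z + derive1 U z * (x - z) + derive1n 2 U z / 2 * (x - z) ^+ 2.
Proof.
move=> xz.
have U'_tangent t :
    derive1 U z + derive1n 2 U z * (t - z) <= derive1 U t.
  have U''_ni := is_derive_le0_nonincreasing (dN dU'').
  have h := is_derive_nonincreasing_tangent (dN dU') _ t z.
  have {}h : - derive1 U t <= - derive1 U z + - derive1n 2 U z * (t - z).
    apply: h; apply: U''_ni => r.
    by rewrite -[(- _) r]/(- derive1n 3 U r) oppr_le0; have [] := U3 r.
  by lra.
pose g t := derive1 U z * (t - z) + derive1n 2 U z / 2 * (t - z) ^+ 2 - U t.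
have dg t : is_derive (t : R) (1 : R) g
    (derive1 U z + derive1n 2 U z * (t - z) - derive1 U t).
  have dl : is_derive (t : R) (1 : R) (fun s : R => s - z) 1.
    have := is_deriveB (is_derive_id (t : R) (1 : R)) (is_derive_cst z (t : R) (1 : R)).
    by rewrite subr0.
  have := is_deriveB (is_deriveD (is_deriveZ (derive1 U z) dl)
    (is_deriveZ (derive1n 2 U z / 2) (is_deriveX 2 dl))) (dU t).
  set h := (X in is_derive _ _ X _) => dh.
  have -> : g = h by apply/funext => s; rewrite /g /h !fctE expr2.
  apply: (is_derive_eq dh).
  by rewrite /GRing.scale/= !mulr1 expr1 mulrA divfK.
have g_ni := is_derive_le0_nonincreasing dg _ xz.
have : g z <= g x by apply: g_ni => t; have := U'_tangent t; lra.
by rewrite /g subrr mulr0 expr0n/= mulr0 addr0; lra.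
Qed.

(** Extends the quadratic bound from the half-line left of z to any half-line:
on [z, zmax] both U and the quadratic term are bounded, at the price of a larger
constant. *)
Lemma prudent_utility_quadratic_bound z zmax : derive1n 2 U z < 0 ->
  exists C, forall x, x <= zmax ->
    U x <= C + derive1n 2 U z / 2 * (x - z) ^+ 2.
Proof.
set k := derive1n 2 U z => k0.
exists (Num.max (U z) (U zmax) - k / 2 * (zmax - z) ^+ 2) => x xmax.
have [xz|zx] := leP x z.
- have := prudent_utility_quadratic xz; rewrite -/k.
  have : derive1 U z * (x - z) <= 0.
    by rewrite mulr_ge0_le0 ?subr_le0// ltW//; exact: utility_increasing.
  have : U z <= Num.max (U z) (U zmax) by rewrite le_max lexx.
  have : 0 <= - (k / 2 * (zmax - z) ^+ 2).
    by rewrite -mulNr mulr_ge0 ?sqr_ge0//; lra.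
  lra.
- have : U x <= Num.max (U z) (U zmax).
    by rewrite le_max (utility_nondecreasing xmax) orbT.
  have : k / 2 * (zmax - z) ^+ 2 <= k / 2 * (x - z) ^+ 2.
    rewrite ler_nM2l; last by lra.
    by rewrite ler_sqr ?nnegrE; lra.
  lra.
Qed.

End utility.

(** * Expectations of concave functions *)

Section expectation.
Context (d : measure_display) (T : measurableType d) (R : realType).
Variable P : probability T R.
Implicit Types f g Z : T -> R.

Local Notation integrable f := (P.-integrable [set: T] (EFin \o f)).
Local Notation "\E f" := (Rintegral P setT f) (at level 10, f at level 8).

Lemma integrable_expectationE f : integrable f -> 'E_P[f]%E = (\E f)%:E.
Proof. by move=> fi; rewrite unlock /Rintegral fineK// integrable_fin_num. Qed.

Lemma prob_integrable_cst c : integrable (fun=> c).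
Proof.
by apply: finite_measure_integrable_cst; rewrite ?ltry//.
Qed.

Lemma prob_integrable_affine c k f : integrable f ->
  integrable (fun w => c + k * f w).
Proof.
move=> fi; rewrite (_ : _ \o _ = (EFin \o fun=> c) \+ (fun w => k%:E * (f w)%:E))%E//.
by apply: integrableD => //; [exact: prob_integrable_cst|exact: integrableZl].
Qed.

Lemma Rexpectation_cst c : \E (fun=> c) = c.
Proof.
by rewrite Rintegral_cst// -[X in c * fine X]/(P [set: T]) probability_setT mulr1.
Qed.

Lemma Rexpectation_affine c k f : integrable f ->
  \E (fun w => c + k * f w) = c + k * \E f.
Proof.
move=> fi; rewrite (@RintegralD _ _ _ _ _ (fun=> c) (fun w => k * f w)%R)//.
- by rewrite Rexpectation_cst RintegralZl.
- exact: prob_integrable_cst.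
- exact: (integrableZl measurableT k fi).
Qed.

(** The positive part of f is dominated by g, so the integral of f can only be
bounded below if its negative part is integrable as well. *)
Lemma integrable_below f g (c : R) : measurable_fun [set: T] f -> integrable g ->
  (forall w, f w <= g w) -> (c%:E <= 'E_P[f])%E -> integrable f.
Proof.
move=> mf gi fg cf.
have mf' : measurable_fun [set: T] (EFin \o f) by exact/measurable_EFinP.
have fp : (\int[P]_x (EFin \o f)^\+%E x < +oo)%E.
  have /integrableP[mg] := gi; apply: le_lt_trans; apply: ge0_le_integral => //.
  - exact: measurable_funepos.
  - exact: measurableT_comp.
  - move=> w _; rewrite funeposE ge_max abse_ge0 andbT.
    by rewrite lee_fin (le_trans (fg w))// ler_norm.
have fn : (\int[P]_x (EFin \o f)^\-%E x < +oo)%E.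
  rewrite ltey; apply/eqP => fny; move: cf.
  rewrite unlock integralE fny/=.
  have : (\int[P]_x (EFin \o f)^\+%E x)%E \is a fin_num.
    by rewrite ge0_fin_numE//; exact: integral_ge0.
  by case: (integral _ _ _) => // r _; rewrite leeNy_eq.
apply/integrableP; split => //.
rewrite (_ : (fun x => _) = (EFin \o f)^\+ \+ (EFin \o f)^\-)%E; last first.
  by rewrite -fune_abse.
rewrite ge0_integralD//.
- exact: lte_add_pinfty.
- exact: measurable_funepos.
- exact: measurable_funeneg.
Qed.

Lemma integrable_measurable f : integrable f -> measurable_fun [set: T] f.
Proof. by move=> /measurable_int/measurable_EFinP. Qed.

Lemma integrable_between f g h : integrable g -> integrable h ->
  measurable_fun [set: T] f -> (forall w, g w <= f w) ->
  (forall w, f w <= h w) -> integrable f.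
Proof.
move=> gi hi mf gf fh.
apply: (le_integrable measurableT _ _
  (integrableD measurableT (integrable_norm gi) (integrable_norm hi))).
  exact/measurable_EFinP.
move=> w _; rewrite /= lee_fin [leRHS]ger0_norm ?addr_ge0//.
have := ler_norm (- g w); have := ler_norm (h w); rewrite normrN.
have := gf w; have := fh w; have := normr_ge0 (g w); have := normr_ge0 (h w).
by rewrite ler_norml => *; apply/andP; split; lra.
Qed.

(** Replacing g by max f g, which is a.e. equal to g, reduces the a.e. comparison
to an everywhere one. *)
Lemma Rexpectation_ae_le f g : integrable f -> integrable g ->
  {ae P, forall w, f w <= g w} -> \E f <= \E g.
Proof.
move=> fi gi fg; have mf := integrable_measurable fi; have mg := integrable_measurable gi.
have mh : measurable_fun [set: T] (fun w => Num.max (f w) (g w)).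
  exact: measurable_maxr.
have hi : integrable (fun w => Num.max (f w) (g w)).
  apply: (integrable_between fi (integrableD measurableT (integrable_norm fi)
    (integrable_norm gi))) => // w; first by rewrite le_max lexx.
  have := ler_norm (f w); have := ler_norm (g w).
  have := normr_ge0 (f w); have := normr_ge0 (g w).
  by rewrite ge_max => *; apply/andP; split; rewrite /=; lra.
have -> : \E g = \E (fun w => Num.max (f w) (g w)).
  congr fine; apply: ae_eq_integral => //; try exact/measurable_EFinP.
  by apply: filterS fg => w fgw _; rewrite max_r.
by apply: le_Rintegral => // w _; rewrite le_max lexx.
Qed.

Section utility.
Variable U : R -> R.
Hypothesis hU : is_utility U.

Lemma measurable_utility_comp Z : measurable_fun [set: T] Z ->
  measurable_fun [set: T] (fun w => U (Z w)).
Proof. exact: measurableT_comp (utility_continuous_measurable hU). Qed.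

Lemma utility_integrable Z (c : R) : integrable Z ->
  (c%:E <= 'E_P[fun w => U (Z w)])%E -> integrable (fun w => U (Z w)).
Proof.
move=> Zi; apply: integrable_below.
- exact/measurable_utility_comp/integrable_measurable.
- exact: (prob_integrable_affine (U 0) (derive1 U 0) Zi).
- by move=> w; have := utility_tangent hU (Z w) 0; rewrite subr0.
Qed.

(** Integrate the tangent inequality at the mean of Z. *)
Lemma utility_jensen Z : integrable Z -> integrable (fun w => U (Z w)) ->
  \E (fun w => U (Z w)) <= U (\E Z).
Proof.
move=> Zi UZi; set e := \E Z.
have <- : \E (fun w => (U e - derive1 U e * e) + derive1 U e * Z w) = U e.
  by rewrite Rexpectation_affine// -/e subrK.
apply: le_Rintegral => //; first exact: prob_integrable_affine.
by move=> w _; have := utility_tangent hU (Z w) e; lra.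
Qed.

(** Used for midpoints of contracts: the agent's wealth is a concave function of
the contract because the effort cost is convex, whence an inequality between Z
and the average of Z1 and Z2.  Monotonicity and concavity of U then make the
expected utility quasi-concave. *)
Lemma utility_expectation_ge Z1 Z2 Z (c : R) :
  integrable Z1 -> integrable Z2 -> integrable Z ->
  (forall w, (Z1 w + Z2 w) / 2 <= Z w) ->
  (c%:E <= 'E_P[fun w => U (Z1 w)])%E -> (c%:E <= 'E_P[fun w => U (Z2 w)])%E ->
  (c%:E <= 'E_P[fun w => U (Z w)])%E.
Proof.
move=> Z1i Z2i Zi Z12 c1 c2.
have U1i := utility_integrable Z1i c1; have U2i := utility_integrable Z2i c2.
have Mi : integrable (fun w => 0 + 2^-1 * (U (Z1 w) + U (Z2 w))).
  exact: (prob_integrable_affine 0 2^-1 (integrableD measurableT U1i U2i)).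
have lo w : 0 + 2^-1 * (U (Z1 w) + U (Z2 w)) <= U (Z w).
  rewrite add0r mulrC; apply: le_trans (utility_midpoint hU _ _) _.
  exact: utility_nondecreasing.
have Ui : integrable (fun w => U (Z w)).
  apply: (integrable_between Mi (prob_integrable_affine (U 0) (derive1 U 0) Zi)) => //.
  - by apply: measurable_utility_comp; exact: integrable_measurable.
  - by move=> w; have := utility_tangent hU (Z w) 0; rewrite subr0.
move: c1 c2; rewrite !integrable_expectationE// !lee_fin => c1 c2.
apply: (@le_trans _ _ (0 + 2^-1 * (\E (fun w => U (Z1 w)) + \E (fun w => U (Z2 w))))).
  by lra.
rewrite -RintegralD// -Rexpectation_affine//; last exact: (integrableD measurableT U1i U2i).
exact: le_Rintegral.
Qed.

End utility.

Section square_integrable.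

Implicit Types W : L2 P.

Lemma L2_integrable_sqr W : integrable (fun w => W w ^+ 2).
Proof. exact: (Lfun2_integrable_sqr (LfunP W)). Qed.

Lemma L2_measurable W : measurable_fun [set: T] W.
Proof. exact: measurable_funPT. Qed.

Lemma L2_integrable W : integrable W.
Proof.
apply/Lfun1_integrable; apply: Lfun_subset12; last exact: LfunP.
exact: fin_num_measure.
Qed.

Lemma L2_of_sqr_integrable f : measurable_fun [set: T] f ->
  integrable (fun w => f w ^+ 2) -> {W : L2 P | W = f :> (T -> R)}.
Proof.
move=> mf fi.
have fP : f \in Lfun P 2%:E.
  apply/andP; split; first by rewrite inE.
  rewrite inE/= /finite_norm unlock; apply: poweR_lty.
  have /integrableP[_] := fi; apply: le_lt_trans.
  rewrite le_eqVlt; apply/orP; left; apply/eqP; apply: eq_integral => w _.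
  by rewrite /= powR_mulrn ?normr_ge0// -normrX.
by exists (Lfun_Sub (lee1n 2) fP).
Qed.

Lemma L2_const (c : R) : {W : L2 P | W = (fun=> c) :> (T -> R)}.
Proof.
by apply: L2_of_sqr_integrable => //; exact: prob_integrable_cst.
Qed.

End square_integrable.

End expectation.

(** * Fast Cauchy sequences in L2 *)

(** The rates are summable, hence so are the increments of a sequence whose n-th
tail lies within the n-th rate of its n-th term; in L2 this gives a.e. convergence
without extracting a subsequence. *)
Definition fast_rate (R : realType) (n : nat) : R := 1 / (2 ^ n.+1)%:R.

Lemma fast_rate_gt0 (R : realType) n : 0 < fast_rate R n.
Proof. by rewrite /fast_rate divr_gt0// ltr0n expn_gt0. Qed.

Lemma fast_rate_nonincreasing (R : realType) n k :
  (n <= k)%N -> fast_rate R k <= fast_rate R n.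
Proof.
move=> nk; rewrite /fast_rate ler_pM2l// lef_pV2 ?posrE ?ltr0n ?expn_gt0//.
by rewrite ler_nat leq_exp2l.
Qed.

Lemma fast_rate_summable (R : realType) :
  (\sum_(0 <= n <oo) (fast_rate R n)%:E < +oo)%E.
Proof. exact: (le_lt_trans (epsilon_trick0 xpredT ler01) (ltry _)). Qed.

Lemma fast_rate_cvg0 (R : realType) : fast_rate R n @[n --> \oo] --> 0.
Proof.
have : (2^-1 : R) * 2^-1 ^+ n @[n --> \oo] --> (2^-1 * 0 : R).
  by apply: cvgMr; apply: cvg_expr; rewrite ger0_norm; lra.
rewrite mulr0; apply: cvg_trans; apply: near_eq_cvg; apply: nearW => n.
by rewrite /fast_rate div1r natrX exprVn exprS invfM.
Qed.

(** Absolute convergence of the telescoping series. *)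
Lemma summable_increments_cvg (R : realType) (x : R^nat) :
  (\sum_(0 <= n <oo) `|x n.+1 - x n|%:E < +oo)%E -> cvgn x.
Proof.
move=> sx.
have h : cvgn (series (telescope x)).
  apply: normed_cvg; apply: nondecreasing_is_cvgn.
    apply: nondecreasing_series => *; exact: normr_ge0.
  exists (fine (\sum_(0 <= n <oo) `|x n.+1 - x n|%:E)%E) => _ [n _ <-].
  rewrite -lee_fin fineK; last first.
    by rewrite ge0_fin_numE//; apply: nneseries_ge0 => k _ _; rewrite lee_fin.
  rewrite /series/= -sumEFin; apply: nneseries_lim_ge => k _ _.
  by rewrite lee_fin.
have -> : x = cst (x 0%N) + series (telescope x).
  by apply/funext => n; exact: eq_sum_telescope.
exact: is_cvgD (is_cvg_cst _) h.
Qed.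

Lemma fast_cauchy_cvg (R : realType) (a : R^nat) :
  (forall n k, (n <= k)%N -> (a n - a k) ^+ 2 <= fast_rate R n ^+ 2) ->
  {b : R | a n @[n --> \oo] --> b & forall n, (a n - b) ^+ 2 <= fast_rate R n ^+ 2}.
Proof.
move=> aC.
have ca : cvgn a.
  apply: summable_increments_cvg; apply: le_lt_trans (fast_rate_summable R).
  apply: lee_nneseries => [n _ _|n _]; rewrite lee_fin// distrC.
  rewrite -ler_sqr ?nnegrE ?(ltW (fast_rate_gt0 _ _))// real_normK ?num_real//.
  exact: aC.
exists (limn a) => // n.
have h : (a n - a k) * (a n - a k) @[k --> \oo] --> (a n - limn a) * (a n - limn a).
  by apply: cvgM; apply: cvgB => //; exact: cvg_cst.
rewrite expr2 -(cvg_lim _ h)//; apply: limr_le; first by apply/cvg_ex; eexists; exact: h.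
by exists n => // k /= nk; rewrite -expr2 aC.
Qed.

Section convergence.
Context (d : measure_display) (T : measurableType d) (R : realType).
Variable P : probability T R.

Local Notation integrable f := (P.-integrable [set: T] (EFin \o f)).
Local Notation "\E f" := (Rintegral P setT f) (at level 10, f at level 8).

(** The form of Fatou's lemma needed below: a.e. convergence instead of an inferior
limit, and bounds c_n on the integrals that converge themselves. *)
Lemma fatou_cvg_le (f : nat -> T -> R) (g : T -> R) (c_ : nat -> R) (c : R) :
  (forall n, measurable_fun [set: T] (f n)) -> (forall n w, 0 <= f n w) ->
  measurable_fun [set: T] g -> (forall w, 0 <= g w) ->
  {ae P, forall w, f n w @[n --> \oo] --> g w} ->
  c_ n @[n --> \oo] --> c ->
  (forall n, \int[P]_w (f n w)%:E <= (c_ n)%:E)%E ->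
  (\int[P]_w (g w)%:E <= c%:E)%E.
Proof.
move=> mf f0 mg g0 fg cc fc.
have mf' n : measurable_fun [set: T] (EFin \o f n) by exact/measurable_EFinP.
have -> : (\int[P]_w (g w)%:E = \int[P]_w limn_einf (fun n => (f n w)%:E))%E.
  apply: ae_eq_integral => //.
  - exact/measurable_EFinP.
  - rewrite (_ : (fun w => _) =
      -%E \o (fun w => limn_esup (fun n => - (f n w)%:E)%E))//.
    apply: measurableT_comp => //; apply: measurable_fun_limn_esup => n.
    by apply: (@measurableT_comp _ _ _ _ _ _ (-%E) _ (EFin \o f n)).
  - apply: filterS fg => w fgw _; apply/esym.
    have /cvg_limn_einf_sup[] // : (f n w)%:E @[n --> \oo] --> (g w)%:E.
    by apply: cvg_EFin => //; exact: nearW.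
apply: (le_trans (fatou P measurableT mf' _)).
  by move=> n w _; rewrite lee_fin.
have <- : limn_einf (fun n => (c_ n)%:E) = c%:E.
  have /cvg_limn_einf_sup[] // : (c_ n)%:E @[n --> \oo] --> c%:E.
  by apply: cvg_EFin => //; exact: nearW.
rewrite !limn_einf_lim; apply: lee_lim; [exact: is_cvg_einfs|exact: is_cvg_einfs|].
apply: nearW => n; apply: le_ereal_inf_tmp => _ [k /= nk <-].
by apply: le_trans (fc k); apply: ereal_inf_lbound; exists k.
Qed.

Lemma ge0_integrable_le (f : T -> R) (c : R) : measurable_fun [set: T] f ->
  (forall w, 0 <= f w) -> (\int[P]_w (f w)%:E <= c%:E)%E ->
  integrable f /\ \E f <= c.
Proof.
move=> mf f0 fc.
have fi : integrable f.
  apply/integrableP; split; first exact/measurable_EFinP.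
  rewrite (le_lt_trans _ (ltry c))//; apply: le_trans fc.
  by under eq_integral do rewrite /= ger0_norm//.
by split => //; rewrite -lee_fin -integrable_expectationE// unlock.
Qed.

(** The Cauchy-Schwarz bound on the first moment, obtained by integrating
|x| <= r / 2 + x^2 / (2 r). *)
Lemma Rexpectation_norm_le (f : T -> R) (r : R) : 0 < r ->
  measurable_fun [set: T] f -> integrable (fun w => f w ^+ 2) ->
  \E (fun w => f w ^+ 2) <= r ^+ 2 -> (\int[P]_w `|f w|%:E <= r%:E)%E.
Proof.
move=> r0 mf f2i f2.
apply: (@le_trans _ _ (\int[P]_w (r / 2 + (2 * r)^-1 * f w ^+ 2)%:E)%E).
  apply: ge0_le_integral => //.
  - by apply/measurable_EFinP; exact: measurableT_comp.
  - apply/measurable_EFinP; apply: measurable_funD => //.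
    by apply: measurable_funM => //; exact: measurable_funX.
  - move=> w _; rewrite lee_fin -subr_ge0.
    have -> : r / 2 + (2 * r)^-1 * f w ^+ 2 - `|f w| =
              (2 * r)^-1 * (r - `|f w|) ^+ 2.
      by rewrite -[f w ^+ 2]real_normK ?num_real//; field; rewrite gt_eqF.
    by rewrite mulr_ge0 ?sqr_ge0// invr_ge0; lra.
have := integrable_expectationE (prob_integrable_affine (r / 2) (2 * r)^-1 f2i).
rewrite unlock => ->; rewrite lee_fin Rexpectation_affine//.
rewrite [leRHS](_ : r = r / 2 + (2 * r)^-1 * r ^+ 2); last first.
  by field; rewrite gt_eqF.
by rewrite lerD2l ler_wpM2l// invr_ge0; lra.
Qed.

(** Riesz-Fischer for fast Cauchy sequences.  The first moments of the increments
are summable, hence so are the increments at almost every point; Fatou's lemma,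
applied to the squared distances to the n-th term, carries the rate to the
limit. *)
Lemma L2_fast_cauchy_cvg (W : nat -> L2 P) :
  (forall n k, (n <= k)%N ->
     \E (fun w => (W n w - W k w) ^+ 2) <= fast_rate R n ^+ 2) ->
  exists2 V : L2 P, {ae P, forall w, W n w @[n --> \oo] --> V w} &
    forall n, \E (fun w => (W n w - V w) ^+ 2) <= fast_rate R n ^+ 2.
Proof.
move=> WC.
have mW n : measurable_fun [set: T] (W n) by exact: L2_measurable.
have ae_cvg : {ae P, forall w, cvgn (W ^~ w)}.
  have mI n : measurable_fun [set: T] (fun w => `|W n.+1 w - W n w|%:E).
    apply/measurable_EFinP; apply: measurableT_comp => //.
    exact: measurable_funB.
  have sum_fin : (\int[P]_w \sum_(0 <= n <oo) `|W n.+1 w - W n w|%:E < +oo)%E.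
    rewrite integral_nneseries//.
    apply: le_lt_trans (fast_rate_summable R).
    apply: lee_nneseries => [n _ _|n _]; first exact: integral_ge0.
    under eq_integral do rewrite distrC.
    apply: (@Rexpectation_norm_le (W n - W n.+1)); first exact: fast_rate_gt0.
    - exact: L2_measurable.
    - exact: L2_integrable_sqr.
    - exact: WC.
  have sum_int : P.-integrable [set: T]
      (fun w => \sum_(0 <= n <oo) `|W n.+1 w - W n w|%:E)%E.
    apply/integrableP; split.
      by apply: ge0_emeasurable_sum => // n w _ _; rewrite lee_fin.
    apply: le_lt_trans sum_fin; under eq_integral => w _.
      rewrite gee0_abs; last by apply: nneseries_ge0 => n _ _; rewrite lee_fin.
      over.
    by [].
  apply: filterS (integrable_ae measurableT sum_int) => w /(_ I) sum_w.
  apply: summable_increments_cvg.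
  by rewrite -ge0_fin_numE//; apply: nneseries_ge0 => n _ _; rewrite lee_fin.
(* The superior limit is measurable everywhere, and is the limit where that exists. *)
pose V0 w := fine (limn_esup (fun n => (W n w)%:E)).
have mV0 : measurable_fun [set: T] V0.
  apply: measurableT_comp => //; apply: measurable_fun_limn_esup => n.
  exact/measurable_EFinP.
have V0_cvg : {ae P, forall w, W n w @[n --> \oo] --> V0 w}.
  apply: filterS ae_cvg => w /cvg_ex[l Wl].
  have : (W n w)%:E @[n --> \oo] --> l%:E by apply: cvg_EFin => //; exact: nearW.
  by rewrite /V0 => /cvg_limn_einf_sup[_ ->].
have V0_rate n : (\int[P]_w ((W n w - V0 w) ^+ 2)%:E <= (fast_rate R n ^+ 2)%:E)%E.
  apply: (@fatou_cvg_le (fun k w => (W n w - W (k + n)%N w) ^+ 2) _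
    (fun=> fast_rate R n ^+ 2)).
  - by move=> k; apply: measurable_funX; exact: measurable_funB.
  - by move=> k w; exact: sqr_ge0.
  - by apply: measurable_funX; exact: measurable_funB.
  - by move=> w; exact: sqr_ge0.
  - apply: filterS V0_cvg => w Ww; rewrite expr2.
    apply: (@cvg_trans _ ((W n w - W (k + n)%N w) * (W n w - W (k + n)%N w) @[k --> \oo])).
      by [].
    have Ww' : W (k + n)%N w @[k --> \oo] --> V0 w by rewrite (cvg_shiftn n (W ^~ w)).
    by apply: cvgM; apply: cvgB => //; exact: cvg_cst.
  - exact: cvg_cst.
  - move=> k; have := WC n (k + n)%N (leq_addl _ _); rewrite -lee_fin.
    have Di := L2_integrable_sqr (W n - W (k + n)%N).
    by rewrite -(integrable_expectationE Di) unlock.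
(* The limit is square integrable because it differs from the first term by a
   square integrable function. *)
have [D DE] : {D : L2 P | D = (fun w => W 0%N w - V0 w) :> (T -> R)}.
  apply: L2_of_sqr_integrable; first exact: measurable_funB.
  apply: (ge0_integrable_le _ _ (V0_rate 0%N)).1 => [|w]; last exact: sqr_ge0.
  by apply: measurable_funX; exact: measurable_funB.
have VE w : (W 0%N - D) w = V0 w.
  by rewrite -[LHS]/(W 0%N w - D w) DE subKr.
exists (W 0%N - D).
  by apply: filterS V0_cvg => w; rewrite VE.
move=> n; under eq_Rintegral do rewrite VE.
apply: (ge0_integrable_le _ _ (V0_rate n)).2 => [|w]; last exact: sqr_ge0.
by apply: measurable_funX; exact: measurable_funB.
Qed.

End convergence.

(** * Near-minimal sequences and existence of maximizers *)

(** N plays the squared norm.  The minimal norms over the nested sets increase to a finite limit s.  Two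
near-minimizers taken far enough in the sequence have norms close to s, and so
does their midpoint, which belongs to the larger of the two sets; the
parallelogram identity then forces them to be close to each other. *)
Lemma near_minimal_sequence (R : realType) (E : lmodType R) (N : E -> R)
    (D : nat -> set E) (b : R) (eps : nat -> R) :
  (forall u, 0 <= N u) ->
  (forall u v, N (u - v) = 2 * N u + 2 * N v - 4 * N (2^-1 *: (u + v))) ->
  (forall n k, (n <= k)%N -> D k `<=` D n) ->
  (forall n u v, D n u -> D n v -> D n (2^-1 *: (u + v))) ->
  (forall n, exists2 u, D n u & N u <= b) ->
  (forall n, 0 < eps n) -> (forall n k, (n <= k)%N -> eps k <= eps n) ->
  exists2 u : nat -> E, (forall n, D n (u n)) &
    forall n k, (n <= k)%N -> N (u n - u k) <= eps n.
Proof.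
move=> N0 parallelogram D_ni D_mid D_bounded eps0 eps_ni.
pose delta n := inf (N @` D n).
have D_lb n : lbound (N @` D n) 0 by move=> _ [u _ <-].
have D_inf n : has_inf (N @` D n).
  by split; [have [u Du _] := D_bounded n; exists (N u), u|exists 0].
have delta_le n u : D n u -> delta n <= N u.
  by move=> Du; apply: ge_inf; [exists 0|exists u].
have delta_nd n k : (n <= k)%N -> delta n <= delta k.
  move=> nk; apply: lb_le_inf; first by have [] := D_inf k.
  by move=> _ [u Du <-]; apply: delta_le; exact: D_ni Du.
have delta_sup : has_sup (range delta).
  split; first by exists (delta 0%N), 0%N.
  by exists b => _ [n _ <-]; have [u Du] := D_bounded n; apply: le_trans; exact: delta_le.
set s := sup (range delta).
have delta_s n : delta n <= s by apply: ub_le_sup; [case: delta_sup|exists n].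
(* The fraction 1/8 makes the errors in the parallelogram identity, with weights
   2, 2 and 4, add up to eps n. *)
have /choice[p pP] n : exists p, (n <= p)%N /\ s - eps n / 8 < delta p.
  have e8 : 0 < eps n / 8 by rewrite divr_gt0.
  have [_ [q _ <-] sq] := sup_adherent e8 delta_sup.
  exists (maxn n q); split; first exact: leq_maxl.
  by apply: lt_le_trans sq _; apply: delta_nd; exact: leq_maxr.
have /choice[u uP] n : exists u, D (p n) u /\ N u < delta (p n) + eps n / 8.
  have e8 : 0 < eps n / 8 by rewrite divr_gt0.
  by have [_ [u Du <-] uN] := inf_adherent e8 (D_inf (p n)); exists u.
exists u => [n|n k nk].
  by apply: D_ni (uP n).1; have [] := pP n.
have : delta (minn (p n) (p k)) <= N (2^-1 *: (u n + u k)).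
  apply: delta_le; apply: D_mid.
  - by apply: D_ni (uP n).1; exact: geq_minl.
  - by apply: D_ni (uP k).1; exact: geq_minr.
have : s - eps n / 8 <= delta (minn (p n) (p k)).
  have [_ pn] := pP n; have [_ pk] := pP k; have := eps_ni _ _ nk.
  by rewrite /minn; case: ifP => _; lra.
rewrite parallelogram.
have [_ un] := uP n; have [_ uk] := uP k; have := eps_ni _ _ nk.
have := delta_s (p n); have := delta_s (p k).
lra.
Qed.

(** Real levels approaching a supremum strictly from below; S may be +oo. *)
Lemma ereal_exhaustion (R : realType) (S : \bar R) : (-oo < S)%E ->
  exists c : nat -> R, [/\ (forall n k, (n <= k)%N -> c n <= c k),
    (forall n, (c n)%:E < S)%E &
    forall x, (forall n, (c n)%:E <= x)%E -> (S <= x)%E].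
Proof.
case: S => [r _|_|//].
- exists (fun n => r - fast_rate R n); split.
  + by move=> n k nk; rewrite lerD2l lerN2 fast_rate_nonincreasing.
  + by move=> n; rewrite lte_fin ltrBlDr ltrDl fast_rate_gt0.
  + case=> [x| |] cx; [|by rewrite leey|by have := cx 0%N].
    rewrite lee_fin -[leLHS]subr0.
    have h : r - fast_rate R n @[n --> \oo] --> r - 0.
      by apply: cvgB; [exact: cvg_cst|exact: fast_rate_cvg0].
    rewrite -(cvg_lim _ h)//; apply: limr_le; first by apply/cvg_ex; eexists; exact: h.
    by apply: nearW => n; rewrite -lee_fin.
- exists (fun n => n%:R); split.
  + by move=> n k nk; rewrite ler_nat.
  + by move=> n; rewrite ltry.
  + case=> [x| |] cx; [|by rewrite leey|by have := cx 0%N].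
    have := cx (Num.bound `|x|); rewrite lee_fin leNgt.
    by rewrite (le_lt_trans (ler_norm x))// archi_boundP.
Qed.

Section contract_space.
Context (d : measure_display) (T : measurableType d) (R : realType).
Variable P : probability T R.

Local Notation E := (L2 P * R)%type.
Local Notation integrable f := (P.-integrable [set: T] (EFin \o f)).
Local Notation "\E f" := (Rintegral P setT f) (at level 10, f at level 8).

Definition sqnormE (u : E) : R := \E (fun w => u.1 w ^+ 2) + u.2 ^+ 2.

Lemma normE_sqrt (u : E) : normE u = Num.sqrt (sqnormE u).
Proof. by rewrite /normE /sqnormE real_normK ?num_real// unlock. Qed.

Lemma sqnormE_ge0 (u : E) : 0 <= sqnormE u.
Proof.
by rewrite addr_ge0 ?sqr_ge0//; apply: Rintegral_ge0 => w _; exact: sqr_ge0.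
Qed.

Lemma sqnormE_parallelogram (u v : E) :
  sqnormE (u - v) = 2 * sqnormE u + 2 * sqnormE v - 4 * sqnormE (2^-1 *: (u + v)).
Proof.
have I (W : L2 P) := L2_integrable_sqr W.
have aff k (W : L2 P) : \E (fun w => k * W w ^+ 2) = k * \E (fun w => W w ^+ 2).
  by rewrite RintegralZl.
have iaff k (W : L2 P) : integrable (fun w => k * W w ^+ 2).
  exact: (integrableZl measurableT k (I W)).
rewrite /sqnormE /=.
have -> : \E (fun w => (u.1 - v.1) w ^+ 2) =
    \E (fun w => 2 * u.1 w ^+ 2) + \E (fun w => 2 * v.1 w ^+ 2)
    - \E (fun w => 4 * (2^-1 *: (u.1 + v.1)) w ^+ 2).
  rewrite -RintegralD// -RintegralB//; last exact: (integrableD measurableT (iaff _ _) (iaff _ _)).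
  apply: eq_Rintegral => w _.
  rewrite -[(u.1 - v.1) w]/(u.1 w - v.1 w).
  rewrite -[(2^-1 *: (u.1 + v.1)) w]/(2^-1 * (u.1 w + v.1 w)).
  by field.
rewrite !aff -[2^-1 *: (u.2 + v.2)]/(2^-1 * (u.2 + v.2)).
by field.
Qed.

(** Besides convergence in norm, convergence a.e. of the wages and of the efforts
is recorded: it is what Fatou's lemma uses. *)
Lemma contract_space_complete (u : nat -> E) :
  (forall n k, (n <= k)%N -> sqnormE (u n - u k) <= fast_rate R n ^+ 2) ->
  exists v : E, [/\ cvgE u v,
    {ae P, forall w, (u n).1 w @[n --> \oo] --> v.1 w} &
    (u n).2 @[n --> \oo] --> v.2].
Proof.
move=> uC.
have [n k nk|V V_cvg V_rate] := L2_fast_cauchy_cvg (W := fun n => (u n).1).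
  apply: le_trans (uC _ _ nk); rewrite /sqnormE/=.
  by rewrite lerDl sqr_ge0.
have [n k nk|a a_cvg a_rate] := @fast_cauchy_cvg R (fun n => (u n).2).
  apply: le_trans (uC _ _ nk); rewrite /sqnormE/=.
  by rewrite lerDr; apply: Rintegral_ge0 => w _; exact: sqr_ge0.
exists (V, a); split => //.
have up : (2 : R) * fast_rate R n @[n --> \oo] --> (2 * 0 : R).
  by apply: cvgMr; exact: fast_rate_cvg0.
rewrite mulr0 in up.
apply: squeeze_cvgr (cvg_cst 0) up; apply: nearW => n.
rewrite normE_sqrt sqrtr_ge0/=.
have r0 := fast_rate_gt0 R n.
rewrite -[leRHS]ger0_norm ?mulr_ge0 ?(ltW r0)// -sqrtr_sqr.
apply: ler_wsqrtr.
apply: (le_trans (lerD (V_rate n) (a_rate n))).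
have h (x : R) : x ^+ 2 + x ^+ 2 <= (2 * x) ^+ 2 by nra.
exact: h.
Qed.

(** The projection argument.  Domination by elements of a fixed ball is weaker than
boundedness of the superlevel sets of J, which fails when J depends on the wage only
through its mean. *)
Lemma usc_concave_maximizer (A : set E) (J : E -> \bar R) :
  (exists2 u, A u & -oo < J u)%E ->
  (forall u v, A u -> A v -> A (2^-1 *: (u + v))) ->
  (forall u v (c : R), A u -> A v -> (c%:E <= J u)%E -> (c%:E <= J v)%E ->
    (c%:E <= J (2^-1 *: (u + v)))%E) ->
  (forall u v, (forall n, A (u n)) -> cvgE u v ->
    {ae P, forall w, (u n).1 w @[n --> \oo] --> v.1 w} ->
    (u n).2 @[n --> \oo] --> v.2 -> A v) ->
  (forall c : R, exists b, forall u, A u -> (c%:E <= J u)%E ->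
    exists u', [/\ A u', (J u <= J u')%E & sqnormE u' <= b]) ->
  strongly_usc_on A J -> has_maximizer A J.
Proof.
move=> [u0 Au0 Ju0] A_mid J_mid A_closed bounded usc.
set S := ereal_sup [set J u | u in A].
have [|c [c_nd c_lt c_sup]] := @ereal_exhaustion R S.
  by apply: lt_le_trans Ju0 _; apply: ereal_sup_ubound; exists u0.
pose D n := [set u | A u /\ ((c n)%:E <= J u)%E].
have D_ni n k : (n <= k)%N -> D k `<=` D n.
  move=> nk u [Au cu]; split => //; apply: le_trans cu.
  by rewrite lee_fin c_nd.
have [b bP] := bounded (c 0%N).
have [||n|n k nk|u uD uC] := near_minimal_sequence (N := sqnormE) (D := D) (b := b)
    (eps := fun n => fast_rate R n ^+ 2) sqnormE_ge0 sqnormE_parallelogram D_ni.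
- by move=> n u v [Au cu] [Av cv]; split; [exact: A_mid|exact: J_mid].
- move=> n; have /ereal_sup_gt[_ [u Au <-] cu] := c_lt n.
  have [u' [Au' Juu' u'b]] : exists u', [/\ A u', (J u <= J u')%E & sqnormE u' <= b].
    by apply: bP => //; apply: le_trans (ltW cu); rewrite lee_fin c_nd.
  by exists u' => //; split => //; apply: le_trans Juu'; exact: ltW.
- by rewrite exprn_gt0// fast_rate_gt0.
- by rewrite ler_sqr ?nnegrE ?(ltW (fast_rate_gt0 _ _))// fast_rate_nonincreasing.
have [v [uv uv1 uv2]] := contract_space_complete uC.
have uA n : A (u n) by have [] := uD n.
have Av : A v by exact: A_closed uA uv uv1 uv2.
exists v => //; apply/eqP; rewrite eq_le; apply/andP; split.
  by apply: ereal_sup_ubound; exists v.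
apply: c_sup => n; apply: le_trans (usc u v uA Av uv).
rewrite limn_esup_lim; apply: lime_ge; first exact: is_cvg_esups.
apply: nearW => k.
have [_ cu] := D_ni _ _ (leq_maxr k n) _ (uD (maxn k n)).
apply: le_trans cu _; apply: ereal_sup_ubound; exists (maxn k n) => //=.
exact: leq_maxl.
Qed.

End contract_space.

(** * Support of a random variable *)

Section support.
Context (d : measure_display) (T : measurableType d) (R : realType).
Variable P : probability T R.

(** A point outside the support has a neighbourhood of measure zero containing
an interval with rational endpoints around the point, and there are only countably
many such intervals. *)
Lemma ae_in_support (X : {mfun T >-> R}) :
  {ae P, forall w, measure_support (distribution P X) (X w)}.
Proof.
pose N (n : nat) (w : T) := forall p q : rat, unpickle n = Some (p, q) ->
  distribution P X `]ratr p, ratr q[%classic = 0%E -> ~ (ratr p < X w < ratr q).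
have aeN : {ae P, forall w, forall n, N n w}.
  apply: ae_foralln => n.
  case E : (unpickle n : option (rat * rat)) => [[p q]|]; last first.
    by apply: nearW => w p q; rewrite E.
  have [pq0|pq] := eqVneq (distribution P X `]ratr p, ratr q[%classic) 0%E.
    exists (X @^-1` `]ratr p, ratr q[%classic); split => //.
      exact: measurable_funPTI.
    move=> w /= /existsNP[p'] /existsNP[q'] /not_implyP[].
    rewrite E => -[<- <-] /not_implyP[_ /contrapT].
    by rewrite in_itv.
  apply: nearW => w p' q'; rewrite E => -[<- <-] pq0.
  by rewrite pq0 eqxx in pq.
apply: filterS aeN => w Nw V oV VXw.
rewrite lt0e measure_ge0 andbT; apply/eqP => V0.
have /nbhs_ballP[e /= e0 eV] : nbhs (X w) V by exact: open_nbhs_nbhs.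
have /rat_in_itvoo[p] : X w - e < X w by rewrite ltrBlDr ltrDl.
rewrite in_itv/= => /andP[ep pX].
have /rat_in_itvoo[q] : X w < X w + e by rewrite ltrDl.
rewrite in_itv/= => /andP[Xq qe].
apply: (Nw (pickle (p, q)) p q); [exact: pickleK| |by rewrite pX Xq].
apply/eqP; rewrite eq_le measure_ge0 andbT -V0.
apply: le_measure; rewrite ?inE//.
- exact: open_measurable.
- move=> x /=; rewrite in_itv/= => /andP[px xq]; apply: eV.
  by rewrite /ball/= ltr_norml; apply/andP; split; lra.
Qed.

End support.

(** * The contracting problem *)

Section contract_problem.
Context (d : measure_display) (T : measurableType d) (R : realType).
Variables (P : probability T R) (B : L2 P) (x0 K : R) (UP UA : R -> R).
Hypotheses (K_gt0 : 0 < K) (UP_utility : is_utility UP) (UA_utility : is_utility UA).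
Variables (y : R).

Local Notation E := (L2 P * R)%type.
Local Notation integrable f := (P.-integrable [set: T] (EFin \o f)).
Local Notation "\E f" := (Rintegral P setT f) (at level 10, f at level 8).

Definition agent_wealth (u : E) (w : T) : R := u.1 w - effort_cost K u.2.

Definition principal_wealth (u : E) (w : T) : R := outcome x0 B u.2 w - u.1 w.

Lemma L2_expectationB (W V : L2 P) : \E (W - V) = \E W - \E V.
Proof. by rewrite -RintegralB//; exact: L2_integrable. Qed.

Lemma agent_wealth_integrable u : integrable (agent_wealth u).
Proof.
have := prob_integrable_affine (- effort_cost K u.2) 1 (L2_integrable u.1).
rewrite (_ : (fun w => _) = agent_wealth u)//.
by apply/funext => w; rewrite /agent_wealth mul1r addrC.
Qed.

Lemma Rexpectation_agent_wealth u :
  \E (agent_wealth u) = \E u.1 - effort_cost K u.2.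
Proof.
have := Rexpectation_affine (- effort_cost K u.2) 1 (L2_integrable u.1).
rewrite (_ : (fun w => _) = agent_wealth u) => [->|]; first by rewrite mul1r addrC.
by apply/funext => w; rewrite /agent_wealth mul1r addrC.
Qed.

Lemma principal_wealthE u w :
  principal_wealth u w = (x0 + u.2) + 1 * (B - u.1) w.
Proof.
rewrite /principal_wealth /outcome -[(B - u.1) w]/(B w - u.1 w).
by rewrite mul1r addrA.
Qed.

Lemma principal_wealth_integrable u : integrable (principal_wealth u).
Proof.
have := prob_integrable_affine (x0 + u.2) 1 (L2_integrable (B - u.1)).
rewrite (_ : (fun w => _) = principal_wealth u)//.
by apply/funext => w; rewrite principal_wealthE.
Qed.

Lemma Rexpectation_principal_wealth u :
  \E (principal_wealth u) = x0 + u.2 + \E B - \E u.1.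
Proof.
have := Rexpectation_affine (x0 + u.2) 1 (L2_integrable (B - u.1)).
rewrite (_ : (fun w => _) = principal_wealth u) => [->|]; last first.
  by apply/funext => w; rewrite principal_wealthE.
by rewrite mul1r L2_expectationB addrA.
Qed.

Lemma midpointE (u v : E) :
  (forall w, (2^-1 *: (u + v) : E).1 w = 2^-1 * (u.1 w + v.1 w)) *
  ((2^-1 *: (u + v) : E).2 = 2^-1 * (u.2 + v.2)).
Proof. by split. Qed.

Lemma effort_cost_midpoint a b :
  effort_cost K (2^-1 * (a + b)) <= (effort_cost K a + effort_cost K b) / 2.
Proof.
rewrite /effort_cost -subr_ge0.
have -> : (K * a ^+ 2 / 2 + K * b ^+ 2 / 2) / 2 - K * (2^-1 * (a + b)) ^+ 2 / 2 =
  K / 8 * (a - b) ^+ 2 by field.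
by rewrite mulr_ge0 ?sqr_ge0// divr_ge0// ltW.
Qed.

Lemma agent_value_midpoint (u v : E) (c : R) :
  (c%:E <= agent_value UA K u)%E -> (c%:E <= agent_value UA K v)%E ->
  (c%:E <= agent_value UA K (2^-1 *: (u + v) : E))%E.
Proof.
apply: (utility_expectation_ge UA_utility (agent_wealth_integrable u)
  (agent_wealth_integrable v) (agent_wealth_integrable (2^-1 *: (u + v)))) => w.
rewrite /agent_wealth !midpointE.
have := effort_cost_midpoint u.2 v.2.
lra.
Qed.

Lemma principal_value_midpoint (u v : E) (c : R) :
  (c%:E <= principal_value UP x0 B u)%E -> (c%:E <= principal_value UP x0 B v)%E ->
  (c%:E <= principal_value UP x0 B (2^-1 *: (u + v) : E))%E.
Proof.
apply: (utility_expectation_ge UP_utility (principal_wealth_integrable u)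
  (principal_wealth_integrable v) (principal_wealth_integrable (2^-1 *: (u + v)))) => w.
rewrite /principal_wealth /outcome !midpointE.
lra.
Qed.

Lemma expectation_normE_le (u v : E) (e : R) : 0 < e -> normE (u - v) <= e ->
  `|\E v.1 - \E u.1| <= e.
Proof.
move=> e0 uve; set D := (u - v).1.
have De : \E (fun w => D w ^+ 2) <= e ^+ 2.
  apply: (@le_trans _ _ (sqnormE (u - v))).
    by rewrite /sqnormE lerDl sqr_ge0.
  rewrite -(sqr_sqrtr (sqnormE_ge0 _)) -normE_sqrt.
  by rewrite ler_sqr ?nnegrE ?(ltW e0)// normE_sqrt sqrtr_ge0.
have D_le := Rexpectation_norm_le e0 (L2_measurable D) (L2_integrable_sqr D) De.
rewrite distrC -L2_expectationB -/D.
apply: (le_trans (le_normr_Rintegral measurableT (L2_integrable D))).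
have Di : integrable (fun w => `|D w|) := integrable_norm (L2_integrable D).
by rewrite -lee_fin -(integrable_expectationE Di) unlock.
Qed.

(** The wage component only converges in L2; the first moment is controlled by
the norm. *)
Lemma cvgE_expectation (u : nat -> E) v : cvgE u v ->
  \E (u n).1 @[n --> \oo] --> \E v.1.
Proof.
move=> uv; apply/cvgrPdist_le => e e0.
have /cvgr0_norm_le/(_ e e0) := uv.
apply: filterS => n une; apply: expectation_normE_le => //.
exact: le_trans (ler_norm _) une.
Qed.

(** Both constraint sets of the problem have this form, with I a closed interval. *)
Definition admissible_in (I : set R) : set E :=
  [set u : E | {ae P, forall w, I (u.1 w)} /\
           ((UA y)%:E <= agent_value UA K u)%E].

Lemma admissible_in_midpoint (I : set R) (u v : E) :
  (forall x z, I x -> I z -> I (2^-1 * (x + z))) ->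
  admissible_in I u -> admissible_in I v -> admissible_in I (2^-1 *: (u + v)).
Proof.
move=> I_mid [uI uA] [vI vA]; split; last exact: agent_value_midpoint.
by apply: filterS2 uI vI => w; rewrite !midpointE; exact: I_mid.
Qed.

(** The gap between the tangent of UA at 0 and UA is nonnegative, so Fatou's lemma
bounds its integral at the limit, while the integral of the affine part passes to
the limit. *)
Lemma agent_value_closed (u : nat -> E) v :
  (forall n, (UA y)%:E <= agent_value UA K (u n))%E -> cvgE u v ->
  {ae P, forall w, (u n).1 w @[n --> \oo] --> v.1 w} ->
  (u n).2 @[n --> \oo] --> v.2 -> ((UA y)%:E <= agent_value UA K v)%E.
Proof.
move=> uA uv uv1 uv2.
have kuv : effort_cost K (u n).2 @[n --> \oo] --> effort_cost K v.2.
  rewrite /effort_cost; apply: cvgMl; apply: cvgMr.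
  by rewrite expr2; under eq_fun do rewrite expr2; exact: cvgM.
set k := derive1 UA 0.
pose gap (t : E) (w : T) := UA 0 + k * agent_wealth t w - UA (agent_wealth t w).
have gap_ge0 t w : 0 <= gap t w.
  by rewrite subr_ge0; have := utility_tangent UA_utility (agent_wealth t w) 0; rewrite subr0.
have mwealth t : measurable_fun [set: T] (agent_wealth t).
  exact: integrable_measurable (agent_wealth_integrable t).
have mgap t : measurable_fun [set: T] (gap t).
  apply: measurable_funB; last exact: (measurable_utility_comp UA_utility).
  by apply: measurable_funD => //; exact: measurable_funM.
have affine_int t := prob_integrable_affine (UA 0) k (agent_wealth_integrable t).
have gap_le t : ((UA y)%:E <= agent_value UA K t)%E ->
    (\int[P]_w (gap t w)%:E <= (UA 0 + k * \E (agent_wealth t) - UA y)%:E)%E.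
  move=> tA; have tUi := utility_integrable UA_utility (agent_wealth_integrable t) tA.
  have gi : integrable (gap t) := integrableB measurableT (affine_int t) tUi.
  have := integrable_expectationE gi; rewrite unlock => ->; rewrite lee_fin.
  rewrite /gap RintegralB// Rexpectation_affine; last exact: agent_wealth_integrable.
  by rewrite lerD2l lerN2 -lee_fin -(integrable_expectationE tUi).
have : (\int[P]_w (gap v w)%:E <= (UA 0 + k * \E (agent_wealth v) - UA y)%:E)%E.
  apply: (@fatou_cvg_le _ _ _ _ (fun n => gap (u n)) _
      (fun n => UA 0 + k * \E (agent_wealth (u n)) - UA y)) => //.
  - apply: filterS uv1 => w uvw.
    have wealth_cvg : agent_wealth (u n) w @[n --> \oo] --> agent_wealth v w.
      exact: cvgB.
    apply: cvgB; first by apply: cvgD; [exact: cvg_cst|exact: cvgMr].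
    apply: (cvg_comp _ _ wealth_cvg); exact: utility_continuous.
  - apply: cvgB; last exact: cvg_cst.
    apply: cvgD; first exact: cvg_cst.
    apply: cvgMr; rewrite Rexpectation_agent_wealth.
    under eq_fun do rewrite Rexpectation_agent_wealth.
    by apply: cvgB => //; exact: cvgE_expectation.
  - by move=> n; exact: gap_le.
move=> /(ge0_integrable_le (mgap v) (gap_ge0 v))[gi g_le].
have Ui : integrable (fun w => UA (agent_wealth v w)).
  rewrite (_ : (fun w => _) =
    (fun w => UA 0 + k * agent_wealth v w - gap v w)); last first.
    by apply/funext => w; rewrite /gap opprB addrC subrK.
  exact: (integrableB measurableT (affine_int v) gi).
rewrite /agent_value (integrable_expectationE Ui) lee_fin.
move: g_le; rewrite /gap RintegralB// Rexpectation_affine; last exact: agent_wealth_integrable.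
by rewrite lerD2l lerN2.
Qed.

Lemma admissible_in_closed (I : set R) (u : nat -> E) v :
  closed I -> (forall n, admissible_in I (u n)) -> cvgE u v ->
  {ae P, forall w, (u n).1 w @[n --> \oo] --> v.1 w} ->
  (u n).2 @[n --> \oo] --> v.2 -> admissible_in I v.
Proof.
move=> Ic uA uv uv1 uv2; split; last first.
  by apply: agent_value_closed uv uv1 uv2 => n; have [] := uA n.
have uI : {ae P, forall w, forall n, I ((u n).1 w)}.
  by apply: ae_foralln => n; have [] := uA n.
apply: filterS2 uI uv1 => w uIw; apply: closed_cvg => //.
exact: nearW.
Qed.

Lemma agent_participation (u : E) : ((UA y)%:E <= agent_value UA K u)%E ->
  y + effort_cost K u.2 <= \E u.1.
Proof.
move=> uA.
have Ui := utility_integrable UA_utility (agent_wealth_integrable u) uA.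
have := utility_jensen UA_utility (agent_wealth_integrable u) Ui.
rewrite Rexpectation_agent_wealth => J.
rewrite -lerBrDr; apply: (utility_le_cancel UA_utility); apply: le_trans J.
by rewrite -lee_fin -(integrable_expectationE Ui).
Qed.

Lemma principal_participation (u : E) (c : R) :
  (c%:E <= principal_value UP x0 B u)%E ->
  c <= UP (x0 + u.2 + \E B - \E u.1).
Proof.
move=> uP.
have Ui := utility_integrable UP_utility (principal_wealth_integrable u) uP.
rewrite -Rexpectation_principal_wealth.
apply: le_trans (utility_jensen UP_utility (principal_wealth_integrable u) Ui).
by rewrite -lee_fin -(integrable_expectationE Ui).
Qed.

Lemma admissible_bounded_sqnorm_le (m M : R) : 0 <= m ->
  exists b, forall u, admissible_in [set x | m <= x <= M] u -> sqnormE u <= b.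
Proof.
move=> m0; exists (M ^+ 2 + 2 * (M - y) / K) => u [uI uA].
have W_le : \E u.1 <= M.
  rewrite -[leRHS](Rexpectation_cst P); apply: Rexpectation_ae_le.
  - exact: L2_integrable.
  - exact: prob_integrable_cst.
  - by apply: filterS uI => w /andP[].
rewrite /sqnormE lerD//.
  rewrite -[leRHS](Rexpectation_cst P); apply: Rexpectation_ae_le.
  - exact: L2_integrable_sqr.
  - exact: prob_integrable_cst.
  - apply: filterS uI => w /andP[mw wM].
    by rewrite ler_sqr ?nnegrE ?(le_trans m0)// (le_trans mw).
rewrite ler_pdivlMr//; have := agent_participation uA; rewrite /effort_cost.
by lra.
Qed.

(** Add the inequality a <= K a^2 / 4 + 1 / K. *)
Lemma effort_sqr_le (a q : R) : effort_cost K a <= a + q ->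
  a ^+ 2 <= 4 * (q + K^-1) / K.
Proof.
rewrite /effort_cost ler_pdivlMr// => aq.
have : 0 <= K / 4 * (a - 2 / K) ^+ 2 by rewrite mulr_ge0 ?sqr_ge0// divr_ge0// ltW.
have -> : K / 4 * (a - 2 / K) ^+ 2 = K * a ^+ 2 / 4 - a + K^-1.
  by field; rewrite gt_eqF.
lra.
Qed.

(** The effort satisfies y + K a^2 / 2 <= E[W] <= a + q, where q depends on c
only. *)
Lemma participation_bound (c : R) : exists b1 b2 : R, forall u : E,
  ((UA y)%:E <= agent_value UA K u)%E -> (c%:E <= principal_value UP x0 B u)%E ->
  u.2 ^+ 2 <= b1 /\ \E u.1 <= b2.
Proof.
have [z zP] := utility_bounded_below UP_utility c.
pose q := x0 + \E B - z.
exists (4 * (q - y + K^-1) / K), ((1 + 4 * (q - y + K^-1) / K) / 2 + q) => u uA uP.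
have uW := agent_participation uA.
have uZ := zP _ (principal_participation uP).
have a2 : u.2 ^+ 2 <= 4 * (q - y + K^-1) / K by apply: effort_sqr_le; rewrite /q; lra.
split => //.
by have := sqr_ge0 (u.2 - 1); rewrite sqrrB1 /q in a2 *; lra.
Qed.

(** An affine utility only sees the mean of the principal's wealth, while the agent
prefers the constant wage E[W] by Jensen's inequality; the constant is at least
y, hence at least m. *)
Lemma risk_neutral_replacement (m : R) (u : E) (c : R) :
  m <= y -> (forall x, derive1n 2 UP x = 0) ->
  admissible_in [set x | m <= x] u -> (c%:E <= principal_value UP x0 B u)%E ->
  exists u' : E, [/\ admissible_in [set x | m <= x] u',
    (principal_value UP x0 B u <= principal_value UP x0 B u')%E &
    sqnormE u' = (\E u.1) ^+ 2 + u.2 ^+ 2].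
Proof.
move=> my UP2 [uI uA] uP.
have uW := agent_participation uA.
have cost_ge0 : 0 <= effort_cost K u.2.
  by rewrite /effort_cost divr_ge0// mulr_ge0 ?sqr_ge0// ltW.
have [W WE] := L2_const P (\E u.1).
have EW : \E W = \E u.1 by rewrite WE Rexpectation_cst.
exists (W, u.2); split.
- split => /=.
    by apply: nearW => w; rewrite WE/=; lra.
  rewrite /agent_value /= WE integrable_expectationE; last exact: prob_integrable_cst.
  rewrite Rexpectation_cst lee_fin; apply: utility_nondecreasing => //; lra.
- have Ui := utility_integrable UP_utility (principal_wealth_integrable u) uP.
  have UE (t : E) : principal_value UP x0 B t = (UP (\E (principal_wealth t)))%:E.
    rewrite /principal_value (utility_affine UP_utility UP2 (\E _)).
    rewrite -Rexpectation_affine; last exact: principal_wealth_integrable.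
    rewrite -integrable_expectationE; last first.
      by apply: prob_integrable_affine; exact: principal_wealth_integrable.
    by congr expectation; apply/funext => w; rewrite (utility_affine UP_utility UP2).
  by rewrite !UE !Rexpectation_principal_wealth/= EW.
- rewrite /sqnormE/= WE; congr (_ + _).
  exact: Rexpectation_cst.
Qed.

(** The principal's wealth Z satisfies Z <= zmax a.e., so integrating
UP Z <= C - k (Z - z)^2 bounds the second moment of Z - z by s; the wage is a combination
of Z, B and the effort. *)
Lemma risk_averse_sqnorm_le (m b2 z c a2 : R) :
  (forall x : R, derivable (derive1n 2 UP) x 1 /\ 0 <= derive1n 3 UP x) ->
  {ae P, forall w, B w <= b2} -> derive1n 2 UP z < 0 ->
  exists b, forall u : E, {ae P, forall w, m <= u.1 w} -> u.2 ^+ 2 <= a2 ->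
    (c%:E <= principal_value UP x0 B u)%E -> sqnormE u <= b.
Proof.
move=> UP3 Bb UPz; set k := - derive1n 2 UP z / 2.
have k0 : 0 < k by rewrite /k; lra.
(* The effort is at most (1 + a2) / 2, since 2 a <= 1 + a^2. *)
pose zmax := x0 + (1 + a2) / 2 + b2 - m.
have [C CP] := prudent_utility_quadratic_bound UP_utility UP3 zmax UPz.
pose s := (C - c) / k.
pose EB := \E (fun w => (B w) ^+ 2).
exists (2 * s + 4 * EB + 8 * a2 + 8 * (x0 - z) ^+ 2 + a2) => u um ua uP.
have Ui := utility_integrable UP_utility (principal_wealth_integrable u) uP.
have [G GE] : {G : L2 P | G = (fun w => principal_wealth u w - z) :> (T -> R)}.
  have [k1 k1E] := L2_const P (x0 + u.2 - z).
  exists (k1 + (B - u.1)); apply/funext => w.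
  rewrite -[LHS]/(k1 w + (B w - u.1 w)) k1E principal_wealthE.
  by rewrite -[(B - u.1) w]/(B w - u.1 w); ring.
have Gi := L2_integrable_sqr G.
have G_le : \E (fun w => G w ^+ 2) <= s.
  rewrite /s ler_pdivlMr//.
  have : c <= C + (- k) * \E (fun w => G w ^+ 2).
    rewrite -Rexpectation_affine//.
    apply: (@le_trans _ _ (\E (fun w => UP (principal_wealth u w)))).
      by rewrite -lee_fin -(integrable_expectationE Ui).
    apply: Rexpectation_ae_le => //; first exact: prob_integrable_affine.
    apply: filterS2 um Bb => w mw Bw; rewrite GE.
    have := CP (principal_wealth u w).
    have -> : derive1n 2 UP z / 2 = - k by rewrite /k; lra.
    apply; rewrite /principal_wealth /outcome /zmax.
    by have := sqr_ge0 (u.2 - 1); rewrite sqrrB1; lra.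
  lra.
rewrite /sqnormE lerD//.
have Bi := L2_integrable_sqr B.
pose h w := (8 * a2 + 8 * (x0 - z) ^+ 2) + 1 * (2 * G w ^+ 2 + 4 * B w ^+ 2).
have hi1 : integrable (fun w => 2 * G w ^+ 2) := integrableZl measurableT 2 Gi.
have hi2 : integrable (fun w => 4 * B w ^+ 2) := integrableZl measurableT 4 Bi.
have hi3 : integrable (fun w => 2 * G w ^+ 2 + 4 * B w ^+ 2) :=
  integrableD measurableT hi1 hi2.
apply: (@le_trans _ _ (\E h)).
  apply: le_Rintegral => //.
  - exact: L2_integrable_sqr.
  - exact: prob_integrable_affine.
  - move=> w _; rewrite /h GE /principal_wealth /outcome.
    have : 0 <= a2 - u.2 ^+ 2 by rewrite subr_ge0.
    set W := u.1 w; set b := B w; set a := u.2 => ?.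
    (* The difference of the two sides is a combination of these squares and of
       a2 - a ^+ 2. *)
    have := sqr_ge0 (2 * (x0 + a + b - z) - W).
    have := sqr_ge0 (a + (x0 - z) - b); have := sqr_ge0 (a - (x0 - z)).
    lra.
rewrite [leLHS](Rexpectation_affine _ _ hi3) RintegralD// !RintegralZl// -/EB.
lra.
Qed.

(** The contract paying y for no effort is admissible and has finite value. *)
Lemma admissible_in_maximizer (I : set R) :
  closed I -> (forall x z, I x -> I z -> I (2^-1 * (x + z))) -> I y ->
  ('E_P[(fun w => `|UP (outcome x0 B 0 w - y)|)%R] < +oo)%E ->
  (forall c : R, exists b, forall u, admissible_in I u ->
    (c%:E <= principal_value UP x0 B u)%E ->
    exists u', [/\ admissible_in I u',
      (principal_value UP x0 B u <= principal_value UP x0 B u')%E &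
      sqnormE u' <= b]) ->
  strongly_usc_on (admissible_in I) (principal_value UP x0 B) ->
  has_maximizer (admissible_in I) (principal_value UP x0 B).
Proof.
move=> I_closed I_mid Iy UPy; apply: usc_concave_maximizer.
- have [W WE] := L2_const P y.
  exists (W, 0).
    split; first by apply: nearW => w; rewrite /= WE.
    rewrite /agent_value/= WE /effort_cost expr0n/= mulr0 mul0r subr0.
    by rewrite integrable_expectationE ?Rexpectation_cst//; exact: prob_integrable_cst.
  have Ui : integrable (fun w => UP (outcome x0 B 0 w - y)).
    apply/integrableP; split; last by move: UPy; rewrite unlock.
    apply/measurable_EFinP; apply: (measurable_utility_comp UP_utility).
    have := integrable_measurable (principal_wealth_integrable (W, 0)).
    by rewrite /principal_wealth/= WE.
  by rewrite /principal_value/= WE (integrable_expectationE Ui) ltNyr.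
- by move=> u v; exact: admissible_in_midpoint.
- by move=> u v c _ _; exact: principal_value_midpoint.
- by move=> u v; exact: admissible_in_closed.
Qed.

End contract_problem.

Unset Implicit Arguments.

Theorem mainTheorem1 (d : measure_display) (T : measurableType d) (R : realType)
    (P : probability T R) (uncountableT : ~ countable [set: T])
    (B : L2 P) (x0 K : R) (K_gt0 : 0 < K)
    (UP UA : R -> R) (UP_utility : is_utility UP) (UA_utility : is_utility UA)
    (y m : R) (y_ge0 : 0 <= y) (m_ge0 : 0 <= m) (m_le_y : m <= y)
    (UP_integrable : ('E_P[(fun w => `|UP (outcome x0 B 0 w - y)|)%R] < +oo)%E) :
  (forall M : R, y <= M ->
     strongly_usc_on (admissible_bounded P UA K y m M)
       (principal_value UP x0 B) ->
     has_maximizer (admissible_bounded P UA K y m M)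
       (principal_value UP x0 B))
  /\
  (strongly_usc_on (admissible P UA K y m) (principal_value UP x0 B) ->
   (exists b1 b2 : R, measure_support (distribution P B) `<=` `[b1, b2]) ->
   (forall x : R, derivable (derive1n 2 UP) x 1 /\ 0 <= derive1n 3 UP x) ->
   has_maximizer (admissible P UA K y m) (principal_value UP x0 B)).
Proof.
split => [M yM|usc [b1 [b2 Bb]] UP3].
- apply: (@admissible_in_maximizer _ _ _ P B x0 K UP UA K_gt0 UP_utility UA_utility y
    [set x | m <= x <= M]) => //.
  + rewrite [X in closed X](_ : _ = [set x | m <= x] `&` [set x | x <= M]).
      by apply: closedI; [exact: closed_ge|exact: closed_le].
    by apply/seteqP; split => x /= /andP.
  + by move=> x z /= /andP[mx xM] /andP[mz zM]; apply/andP; split; lra.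
  + by rewrite /= m_le_y.
  + move=> c.
    have [b bP] := admissible_bounded_sqnorm_le P K_gt0 UA_utility y M m_ge0.
    by exists b => u uA _; exists u; split => //; exact: bP.
- apply: (@admissible_in_maximizer _ _ _ P B x0 K UP UA K_gt0 UP_utility UA_utility y
    [set x | m <= x]) => //.
  + by move=> x z /= mx mz; lra.
  + move=> c.
    have [a2 [e2 participation]] :=
      participation_bound B x0 K_gt0 UP_utility UA_utility y c.
    have B_le : {ae P, forall w, B w <= b2}.
      apply: filterS (ae_in_support P B) => w /Bb.
      by rewrite /= in_itv/= => /andP[].
    have [[z UPz]|UP2] := pselect (exists z, derive1n 2 UP z < 0).
    * have [b bP] := risk_averse_sqnorm_le x0 UP_utility m c a2 UP3 B_le UPz.
      exists b => u uA uP; exists u; split => //.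
      have [um uy] := uA; have [ua _] := participation _ uy uP.
      exact: bP.
    * exists (e2 ^+ 2 + a2) => u uA uP.
      have UP2E x : derive1n 2 UP x = 0.
        apply/eqP; rewrite eq_le utility_concave//= leNgt; apply/negP => UPx.
        by apply: UP2; exists x.
      have [u' [u'A u'P u'E]] :=
        risk_neutral_replacement K_gt0 UP_utility UA_utility m_le_y UP2E uA uP.
      exists u'; split => //; rewrite u'E.
      have [_ uy] := uA; have [ua uW] := participation _ uy uP.
      have W_ge0 : 0 <= Rintegral P setT u.1.
        apply: le_trans (agent_participation UA_utility uy).
        by rewrite addr_ge0// /effort_cost divr_ge0// mulr_ge0 ?sqr_ge0// ltW.
      by rewrite lerD// ler_sqr ?nnegrE// (le_trans W_ge0).
Qed.
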